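(* Let $\tilde\lambda\in[0,\infty)$. There exists $c_0>0$, depending only on $\tilde\lambda$, such that for all $0<c<c_0$, every fixed single-particle map $f_c$ of capacity $c$ in the class $\mathcal{C}(c,\tilde\lambda)$, and every sequence $(\theta_k)_{k\ge 1}$ of angles in $[0,2\pi]$, the following holds. Set $f_k(z)=e^{i\theta_k}f_c(e^{-i\theta_k}z)$ and $\Psi_n=f_1\circ\cdots\circ f_n$. Then there exists $\epsilon>0$ such that for all $r>1$, $$\limsup_{n\to\infty}\ \sup_{|z|>r}\left|e^{-cn}\Psi_n(z)-z\right|>\epsilon .$$ In particular, if $(\theta_k)_{k\ge1}$ are i.i.d. uniform on $[0,2\pi]$, then $\Psi_n$ is the HL$(0)$ process and the inequality above holds for it, i.e. HL$(0)$ does not converge to a disk under capacity rescaling.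
   Context: $\Delta=\{z\in\mathbb{C}:|z|>1\}$. For $c>0$ and $\tilde\lambda\in[0,\infty)$, the class $\mathcal{C}(c,\tilde\lambda)$ consists of the conformal (injective holomorphic) maps $f_c:\Delta\to\Delta$, taking $\Delta$ onto $\Delta$ minus a particle of logarithmic capacity $c$ attached at $z=1$, which have the form $$f_c(z)=e^{c}z\exp\left(\frac{2c}{z-1}+\delta_c(z)\right),\qquad |\delta_c(z)|<\frac{\tilde\lambda\, c^{3/2}|z|}{|z-1|(|z|-1)}\quad (z\in\Delta).$$ The logarithmic capacity of a conformal map $f$ on $\Delta$ is $\log f'(\infty)=\lim_{z\to\infty}\log f'(z)$. The HL$(0)$ process is the random sequence of maps obtained by composing rotated copies of one fixed map $f_c$ with i.i.d. uniform rotation angles, as in the claim. *)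

(* Defs.v *)
From HB Require Import structures.
From mathcomp Require Import all_boot all_order all_algebra.
From mathcomp Require Import finmap complex.
From mathcomp Require Import all_classical all_reals all_analysis.

Set Implicit Arguments.
Unset Strict Implicit.
Unset Printing Implicit Defensive.

Import Order.TTheory GRing.Theory Num.Theory.
Import numFieldNormedType.Exports.

Local Open Scope classical_set_scope.
Local Open Scope ring_scope.
Local Open Scope complex_scope.

(* The complex plane.  The alias ^o is what carries the topology and the
   normed-space structure of R[i] over itself, so that [derivable] and [derive1]
   below are complex differentiability and the complex derivative. *)
Notation CC R := (R[i]^o).

Section ComplexPlane.
Context {R : realType}.
Implicit Types (z : CC R) (f : CC R -> CC R).

(* The modulus as an element of R; the generic norm of R[i] is R[i]-valued. *)
Definition cmod z : R := Normc.normc z.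

Definition expC z : CC R :=
  (expR (complex.Re z) * cos (complex.Im z)) +i*
  (expR (complex.Re z) * sin (complex.Im z)).

Definition Delta : set (CC R) := [set z | 1 < cmod z].

(* Filter of the neighbourhoods of the point at infinity. *)
Definition infty_nbhs : set_system (CC R) :=
  [set A | exists M : R, forall z, M < cmod z -> A z].

(* log f'(oo) = c, where f'(oo) is the limit of f' at infinity, a positive
   real number a. *)
Definition has_log_capacity f (c : R) : Prop :=
  exists a : R,
    [/\ 0 < a, derive1 f @ infty_nbhs --> (a%:C : CC R) & c = ln a].

(* A particle attached at 1: a part P of Delta which together with the closed
   unit disk forms a compact connected cluster, and which accumulates at 1. *)
Definition particle_attached_at1 (P : set (CC R)) : Prop :=
  let K := [set z | cmod z <= 1] `|` P in
  [/\ P `<=` Delta, compact K, connected K & closure P 1].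

Definition conformal_on (D : set (CC R)) f : Prop :=
  (forall z, D z -> derivable f z 1) /\ set_inj D f.

(* The class C(c, lam).  Maps on Delta are total functions of which only the
   values on Delta matter. *)
Definition particle_map_class (c lam : R) f : Prop :=
  [/\ conformal_on Delta f,
      has_log_capacity f c,
      exists2 P : set (CC R),
        particle_attached_at1 P & f @` Delta = Delta `\` P
    & exists delta : CC R -> CC R, forall z, Delta z ->
        f z = (expR c)%:C * z * expC ((2 * c)%:C / (z - 1) + delta z) /\
        cmod (delta z) <
          lam * c `^ (3 / 2) * cmod z / (cmod (z - 1) * (cmod z - 1)) ].

Definition rotate_map f (t : R) : CC R -> CC R :=
  fun z => expC (0 +i* t) * f (expC (0 +i* (- t)) * z).

(* Psi_n = f_1 o ... o f_n; the angles are numbered from 1 and theta 0 is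
   not used. *)
Fixpoint Psi f (theta : nat -> R) (n : nat) : CC R -> CC R :=
  if n is m.+1 then Psi f theta m \o rotate_map f (theta n) else id.

Definition capacity_rescaled_deviation (c : R) (F : nat -> CC R -> CC R)
    (r : R) (n : nat) : \bar R :=
  ereal_sup [set (cmod ((expR (- (c * n%:R)))%:C * F n z - z))%:E
            | z in [set z | r < cmod z]].

Definition stays_away_from_disk (c : R) (F : nat -> CC R -> CC R) : Prop :=
  exists2 eps : R, 0 < eps & forall r : R, 1 < r ->
    (eps%:E < limn_esup (capacity_rescaled_deviation c F r))%E.

End ComplexPlane.

Lemma twopi_gt0 (R : realType) : (0 : R) < 2 * pi.
Proof. by rewrite mulr_gt0 // pi_gt0. Qed.

Section Angles.
Context {R : realType} {d : measure_display} {T : measurableType d}.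
Variable P : probability T R.
Implicit Type X : nat -> {RV P >-> R}.

Definition mutually_independent X : Prop :=
  forall (J : {fset nat}) (A : nat -> set R),
    (forall k, measurable (A k)) ->
    P (\bigcap_(k in [set` J]) (X k @^-1` A k)) =
    (\prod_(k <- J) P (X k @^-1` A k))%E.

Definition uniform_angle (Y : {RV P >-> R}) : Prop :=
  forall A : set R, measurable A ->
    distribution P Y A = uniform_prob (@twopi_gt0 R) A.

(* Shifted by one because the angles are numbered from 1. *)
Definition iid_uniform_angles X : Prop :=
  mutually_independent (fun k => X k.+1) /\
  forall k, uniform_angle (X k.+1).

Definition HL0 (f : CC R -> CC R) X (w : T) (n : nat) : CC R -> CC R :=
  Psi f (fun k => X k w) n.

End Angles.

(* Main.v *)
Require Import Defs.
From mathcomp Require Import all_boot all_order all_algebra.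
From mathcomp Require Import finmap complex.
From mathcomp Require Import all_classical all_reals all_analysis.
From mathcomp Require Import ring lra.
Import Order.TTheory GRing.Theory Num.Theory.
Import numFieldNormedType.Exports.
Local Open Scope classical_set_scope.
Local Open Scope ring_scope.

(** Write [Phi_n = e^(-cn) Psi_n] for the rescaled clusters, so that
    [Phi_(n+1) = e^(-c) (Phi_n \o f_(n+1))].  If [Phi_n] and [Phi_(n+1)] were
    both uniformly close to the identity near infinity, then [e^(-c) f_(n+1)]
    would be close to it as well.  But [e^(-c) f_c(z) = z + a + O(1/z)], where
    the constant [a] differs from [2c] by at most the order of
    [lam c^(3/2)], hence [|a| >= c] as soon as [lam * sqrt c] is small.  One
    attached particle therefore displaces points arbitrarily far from the
    origin by a fixed amount, and at every step one of two consecutive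
    deviations is at least [c / 2], whatever the angles are.

    Moduli suffice to carry this out: [cmod_particle_map_ge] says that on the
    ray through the attachment point [e^(-c) f_c] moves points outwards by at
    least [c], and [consecutive_deviations] compares this with the deviations
    of [Phi_n] and [Phi_(n+1)] at a point of that ray, rotated by the angle of
    the last particle. *)

Section Modulus.
Context {R : realType}.
Implicit Types (w z : CC R) (x : R).

Lemma cmodM w z : cmod (w * z) = cmod w * cmod z.
Proof. exact: Normc.normcM. Qed.

Lemma cmodN z : cmod (- z) = cmod z.
Proof. exact: normcN. Qed.

Lemma ler_cmodD w z : cmod (w + z) <= cmod w + cmod z.
Proof. exact: le_normcD. Qed.

Lemma cmod_ge0 z : 0 <= cmod z.
Proof. by case: z => a b; rewrite /cmod /= sqrtr_ge0. Qed.

Lemma lerB_cmod w z : cmod w - cmod z <= cmod (w - z).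
Proof. by have := ler_cmodD (w - z) z; rewrite subrK; lra. Qed.

Lemma cmod_real x : cmod (x%:C)%C = `|x|.
Proof. by rewrite /cmod /= expr0n /= addr0 sqrtr_sqr. Qed.

Lemma ler_norm_Re z : `|complex.Re z| <= cmod z.
Proof.
by case: z => a b; rewrite /cmod /= -sqrtr_sqr ler_wsqrtr// lerDl sqr_ge0.
Qed.

Lemma cmod_expC z : cmod (expC z) = expR (complex.Re z).
Proof.
rewrite /cmod /expC /= !exprMn -mulrDr cos2Dsin2 mulr1 sqrtr_sqr.
by rewrite ger0_norm ?expR_ge0.
Qed.

Lemma cmod_expC_arg x : cmod (expC (0 +i* x)%C) = 1.
Proof. by rewrite cmod_expC expR0. Qed.

Lemma expCN_arg x : expC (0 +i* (- x))%C * expC (0 +i* x)%C = 1.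
Proof.
rewrite /expC /= expR0 !mul1r cosN sinN; apply/eqP.
rewrite eq_complex /=; apply/andP; split; apply/eqP; last by ring.
by rewrite mulNr opprK -!expr2 cos2Dsin2.
Qed.

End Modulus.

Section Particle.
Context {R : realType}.

(** On the ray through the attachment point the Loewner term [2c / (x - 1)] is
    real and positive, so it fully contributes to the growth of the modulus,
    and the error term takes away at most half of it once [x >= 2]: this is
    where [lam * sqrt c <= 1/2] is used. *)
Lemma cmod_particle_map_ge (c lam x : R) (f : CC R -> CC R) :
  0 < c -> lam * Num.sqrt c <= 2^-1 -> particle_map_class c lam f ->
  2 <= x -> expR c * (x + c) <= cmod (f (x%:C)%C).
Proof.
move=> c0 lamc [_ _ _ [delta hf]] x2.
have xD : Delta (x%:C)%C by rewrite /Delta /mkset cmod_real ger0_norm; lra.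
have [-> hd] := hf _ xD.
have x1 : 0 < x - 1 by lra.
have eqx : ((x%:C)%C - 1 = ((x - 1)%:C)%C :> CC R) by rewrite rmorphB rmorph1.
rewrite eqx !cmod_real !ger0_norm ?(ltW x1) in hd; [|lra..].
have c32 : c `^ (3 / 2) = c * Num.sqrt c.
  have -> : 3 / 2 = 1 + 2^-1 :> R by field.
  rewrite powRD; last by rewrite (gt_eqF c0) implybT.
  by rewrite powRr1 ?(ltW c0)// powR12_sqrt// ltW.
have hd' : cmod (delta (x%:C)%C) <= c / (x - 1).
  apply: (le_trans (ltW hd)).
  rewrite c32 ler_pdivrMr ?mulr_gt0//.
  have -> : c / (x - 1) * ((x - 1) * (x - 1)) = c * (x - 1) by field; lra.
  have -> : lam * (c * Num.sqrt c) * x = lam * Num.sqrt c * (c * x) by ring.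
  apply: (@le_trans _ _ (2^-1 * (c * x))); last by nra.
  by rewrite ler_wpM2r// mulr_ge0; lra.
rewrite !cmodM !cmod_real cmod_expC !ger0_norm ?expR_ge0; [|lra..].
rewrite -mulrA ler_wpM2l ?expR_ge0//.
have hRe : c / (x - 1) <=
    complex.Re (((2 * c)%:C)%C / ((x%:C)%C - 1) + delta (x%:C)%C).
  rewrite eqx -fmorphV -rmorphM raddfD /=.
  have := ler_norm_Re (delta (x%:C)%C); rewrite ler_norml => /andP[h _].
  have -> : 2 * c / (x - 1) = c / (x - 1) + c / (x - 1) by field; lra.
  by lra.
apply: (@le_trans _ _ (x * (1 + c / (x - 1)))).
  rewrite mulrDr mulr1 lerD2l mulrA ler_pdivlMr// mulrC.
  by rewrite ler_pM2r//; lra.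
rewrite ler_wpM2l//; first by lra.
by apply: le_trans (expR_ge1Dx _); rewrite lerD2l.
Qed.

Lemma cmod_rotate_map f (t x : R) :
  cmod (rotate_map f t (expC (0 +i* t)%C * (x%:C)%C)) = cmod (f (x%:C)%C).
Proof. by rewrite /rotate_map mulrA expCN_arg mul1r cmodM cmod_expC_arg mul1r. Qed.

End Particle.

Section Deviation.
Context {R : realType}.

(** For [w = f_(n+1) z] one has [Phi_(n+1) z = e^(-c) Phi_n w], so if the
    deviations of [Phi_n] at [w] and of [Phi_(n+1)] at [z] were both small,
    [|e^(-c) w|] would be close to [|z|], whereas it is at least [|z| + c] for [z]
    on the ray through the attachment point of the last particle. *)
Lemma consecutive_deviations (c lam r : R) (f : CC R -> CC R)
    (theta : nat -> R) (n : nat) :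
  0 < c -> lam * Num.sqrt c <= 2^-1 -> particle_map_class c lam f ->
  ((c / 2)%:E <= capacity_rescaled_deviation c (Psi f theta) r n)%E \/
  ((c / 2)%:E <= capacity_rescaled_deviation c (Psi f theta) r n.+1)%E.
Proof.
move=> c0 lamc hf.
pose x := Num.max 2 (r + 1).
have x2 : 2 <= x by rewrite le_max lexx.
have xr : r < x by rewrite lt_max; apply/orP; right; lra.
pose z : CC R := expC (0 +i* theta n.+1)%C * (x%:C)%C.
pose w : CC R := rotate_map f (theta n.+1) z.
have zx : cmod z = x by rewrite cmodM cmod_expC_arg mul1r cmod_real ger0_norm; lra.
have wx : expR c * (x + c) <= cmod w.
  by rewrite cmod_rotate_map; exact: cmod_particle_map_ge hf x2.
have wr : r < cmod w.
  have : 1 <= expR c by rewrite -expR0 ler_expR ltW.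
  by nra.
pose A : CC R := ((expR (- (c * n%:R)))%:C)%C * Psi f theta n w - w.
pose B : CC R := ((expR (- (c * n.+1%:R)))%:C)%C * Psi f theta n.+1 z - z.
have BE : B = ((expR (- c))%:C)%C * w - z + ((expR (- c))%:C)%C * A.
  have -> : B = ((expR (- c))%:C * (expR (- (c * n%:R)))%:C)%C
                 * Psi f theta n w - z.
    rewrite -rmorphM -expRD; congr (((expR _)%:C)%C * _ - _).
    by rewrite -natr1; ring.
  by rewrite /A; ring.
have AB : c <= cmod A + cmod B.
  have e0 := expR_gt0 (- c).
  have e1 : expR (- c) <= 1 by rewrite -expR0 ler_expR; lra.
  have h1 : x + c <= expR (- c) * cmod w.
    by rewrite expRN mulrC ler_pdivlMr ?expR_gt0// mulrC.
  have h2 := lerB_cmod (((expR (- c))%:C)%C * w) z.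
  have h3 := lerB_cmod (((expR (- c))%:C)%C * w - z) (- (((expR (- c))%:C)%C * A)).
  have dil u : cmod (((expR (- c))%:C)%C * u) = expR (- c) * cmod u.
    by rewrite cmodM cmod_real ger0_norm ?expR_ge0.
  rewrite dil zx in h2; rewrite opprK -BE cmodN dil in h3.
  have h4 : expR (- c) * cmod A <= cmod A by rewrite ler_piMl ?cmod_ge0.
  by lra.
have [hA|hA] := leP (c / 2) (cmod A); [left|right].
  apply: (@le_trans _ _ (cmod A)%:E); first by rewrite lee_fin.
  by apply: ereal_sup_ubound; exists w.
apply: (@le_trans _ _ (cmod B)%:E); first by rewrite lee_fin; lra.
by apply: ereal_sup_ubound; exists z => //; rewrite /mkset zx.
Qed.

Lemma limn_esup_ge (u : (\bar R)^nat) (a : \bar R) :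
  (forall N, exists2 n, (N <= n)%N & (a <= u n)%E) -> (a <= limn_esup u)%E.
Proof.
move=> au; apply: le_ereal_inf_tmp => _ [V [N _ NV] <-].
have [n Nn /le_trans] := au N; apply.
by apply: ereal_sup_ubound; exists n => //; exact: NV.
Qed.

Lemma particle_map_stays_away (c lam : R) (f : CC R -> CC R)
    (theta : nat -> R) :
  0 < c -> lam * Num.sqrt c <= 2^-1 -> particle_map_class c lam f ->
  stays_away_from_disk c (Psi f theta).
Proof.
move=> c0 lamc hf; exists (c / 4); first by lra.
move=> r _; apply: (@lt_le_trans _ _ (c / 2)%:E); first by rewrite lte_fin; lra.
apply: limn_esup_ge => N.
have [h|h] := consecutive_deviations c lam r f theta N c0 lamc hf; first by exists N.
by exists N.+1.
Qed.

End Deviation.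

Theorem theorem1p1 (R : realType) (lam : R) (lam_ge0 : 0 <= lam) :
  exists2 c0 : R, 0 < c0 &
  forall (c : R) (f : CC R -> CC R), 0 < c -> c < c0 ->
    particle_map_class c lam f ->
    (forall theta : nat -> R,
        (forall k, (1 <= k)%N -> 0 <= theta k <= 2 * pi) ->
        stays_away_from_disk c (Psi f theta))
    /\
    (forall (d : measure_display) (T : measurableType d)
        (P : probability T R) (Theta : nat -> {RV P >-> R}),
        iid_uniform_angles Theta ->
        {ae P, forall w, stays_away_from_disk c (HL0 f Theta w)}).
Proof.
have l0 : 0 < 2 * (lam + 1) by lra.
(* Dividing by [lam + 1] instead of [lam] covers the case [lam = 0]. *)
exists ((2 * (lam + 1))^-1 ^+ 2); first by rewrite exprn_gt0 ?invr_gt0.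
move=> c f c0 cc0 hf.
have lamc : lam * Num.sqrt c <= 2^-1.
  have sc : Num.sqrt c <= (2 * (lam + 1))^-1.
    by rewrite -(ger0_norm (ltW (_ : 0 < _^-1))) ?invr_gt0// -sqrtr_sqr ler_wsqrtr// ltW.
  have := sqrtr_ge0 c.
  by rewrite -[X in _ <= X]div1r ler_pdivlMr// in sc; nra.
split=> [theta _|d T P Theta _]; first exact: particle_map_stays_away hf.
by apply: aeW => w; exact: particle_map_stays_away hf.
Qed.
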